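(* Let $\alpha$ be an ordinal, $M,N\in\mathrm{pSh}(\Omega,L)$, $\bar a\in{}^{<\mu}|M|$, $\bar b\in{}^{\mathrm{lh}(\bar a)}|N|$, and let $h:M\to N$ be a partial isomorphism with $h(a_i)=b_i$ for all $i<\mathrm{lh}(\bar a)$ (and so $E\bar a=E\bar b$). Assume $|M|\cap|N|=\emptyset$. Then $h$ shows $(M,\bar a)\sim^{E\bar a}_\alpha(N,\bar b)$ (i.e. $h\in Q_\alpha(E\bar a)$) if and only if player II has a winning strategy for the game $G^\mu_\alpha(M,\bar a,N,\bar b,h)$.
   Context: **Presheaves.** Fix a complete Heyting algebra $\Omega$ (top $\top$) and cardinals $\lambda$, $\mu$. A presheaf $M$ over $\Omega$ is a set $|M|$ of sections with maps $E:|M|\to\Omega$ (extent) and $\upharpoonright:|M|\times\Omega\to|M|$ (restriction) such that $a\upharpoonright Ea=a$, $E(a\upharpoonright p)=Ea\wedge p$, $(a\upharpoonright p)\upharpoonright q=a\upharpoonright(p\wedge q)$. Put $[a=b]_M=\bigvee\{p\le Ea\wedge Eb: a\upharpoonright p=b\upharpoonright p\}$; presheaves are extensional: $Ea=Eb=[a=b]_M$ implies $a=b$. For $p\in\Omega$, $|M\upharpoonright p|=\{a\in|M|:Ea\le p\}$. For a tuple $\bar a=\langle a_i:i<\gamma\rangle$ of sections, $\mathrm{lh}(\bar a)=\gamma$, $E\bar a=\bigwedge_iEa_i$ ($E\emptyset=\top$), $\bar a\upharpoonright p=\langle a_i\upharpoonright p\rangle_i$, $[\bar a=\bar b]_M=\bigwedge_i[a_i=b_i]_M$.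 ${}^{\gamma}X$ (${}^{<\mu}X$) is the set of tuples from $X$ of length $\gamma$ (less than $\mu$). **Structures.** A signature has finitary relation symbols, finitary function symbols and a presheaf over $\Omega$ of constant symbols (so each constant $c$ has an extent $Ec$). An element $M$ of $\mathrm{pSh}(\Omega,L)$ is a presheaf with: for each $n$-ary $R$ a map $R^M:|M|^n\to\Omega$ with $R^M(\bar a)\le E\bar a$ and $[\bar a=\bar b]_M\wedge R^M(\bar a)\le R^M(\bar b)$; for each $n$-ary $f$ a map $f^M:|M|^n\to|M|$ with $Ef^M(\bar a)=E\bar a$ and $[\bar a=\bar b]_M\le[f^M(\bar a)=f^M(\bar b)]_M$; for each constant $c$ a section $\mathfrak c^M$ with $E\mathfrak c^M=Ec$, compatibly with restriction. **Partial isomorphisms.** For $A\subseteq|M|$, $\langle A\rangle=\{a\upharpoonright p:a\in A,p\in\Omega\}$. A partial isomorphism $h:M\to N$ is a bijection $h:A\to B$, $A\subseteq|M|$, $B\subseteq|N|$, with $[a_0=a_1]_M=[h(a_0)=h(a_1)]_N$ on $A$, such that, extending $h$ to $\langle A\rangle$ by $h(a\upharpoonright p)=h(a)\upharpoonright p$ (well defined), for all sections $x,y,x_0,\dots\in\langle A\rangle$: $[x=y]_M=[h(x)=h(y)]_N$; $R^M(x_0,\dots,x_{n-1})=R^N(h(x_0),\dots,h(x_{n-1}))$ for relation symbols $R$; $[x=\mathfrak c^M]_M=[h(x)=\mathfrak c^N]_N$ for constants $c$; $[f^M(x_0,\dots,x_{n-1})=x_n]_M=[f^N(h(x_0),\dots,h(x_{n-1}))=h(x_n)]_N$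 for function symbols $f$. The extended map is also denoted $h$; domains, ranges, values and inclusions below refer to the extended maps; $h_q$ is the restriction of $h$ to sections of extent exactly $q$. **$Q_\alpha(p)$.** $Q_0(p)$ is the class of all partial isomorphisms between elements of $\mathrm{pSh}(\Omega,L)$; $Q_\alpha(p)=\bigcap_{\beta<\alpha}Q_\beta(p)$ for limit $\alpha$; $h:M\to N$ is in $Q_{\beta+1}(p)$ iff $h\in Q_\beta(p)$ and: (Forth) for every $\bar c=\langle c_i:i<\gamma\rangle$, $\gamma<\mu$, from $|M\upharpoonright p|$ there is a set $\{(h_j,q_j,\bar d_j):j\in J\}$ such that for each $j$: $h_j:M\to N$ is in $Q_\beta(q_j)$, $h_{q_j}\subseteq h_j$, $\bar d_j=\langle d_{ji}:i<\gamma\rangle$ is from $|N\upharpoonright E\bar c|$, $E\bar d_j=q_j$, $c_i\upharpoonright q_j\in\mathrm{dom}(h_j)$ and $h_j(c_i\upharpoonright q_j)=d_{ji}$ for all $i<\gamma$; and $\bigvee_jq_j=E\bar c$; (Back) for every $\bar d=\langle d_i:i<\gamma\rangle$, $\gamma<\mu$, from $|N\upharpoonright p|$ there is a set $\{(h_j,q_j,\bar c_j):j\in J\}$ such that for each $j$: $h_j:M\to N$ is in $Q_\beta(q_j)$, $h_{q_j}\subseteq h_j$, $d_i\upharpoonright q_j\in\mathrm{rge}(h_j)$ for all $i$, $\bar c_j=\langle c_{ji}:i<\gamma\rangle$ is from $|M\upharpoonright E\bar d|$, $E\bar c_j=q_j$, $h_j(c_{ji})=d_i\upharpoonright q_j$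 for all $i<\gamma$; and $\bigvee_jq_j=E\bar d$. For $\bar a\in{}^{<\lambda}|M\upharpoonright p|$ and $\bar b\in{}^{\mathrm{lh}(\bar a)}|N\upharpoonright p|$, $(M,\bar a)\sim^p_\alpha(N,\bar b)$ means that the map $a_i\mapsto b_i$ is in $Q_\alpha(p)$. **Game $G^\mu_\alpha(M,\bar a,N,\bar b,h)$.** At move $n$ player I plays $(\bar s_n,\alpha_n)$ with $\bar s_n\in{}^{<\mu}|M|\cup{}^{<\mu}|N|$ and $\alpha_n<\alpha$; player II answers with a set $\{(h_j,q_j,\bar t_j):j\in J_n\}$. At move $0$ player I must ensure $E\bar s_0\le E\bar a$; set $h^*_0=h$. At move $n$ player II must ensure, for each $j\in J_n$: $\bar t_j$ is a tuple of length $\mathrm{lh}(\bar s_n)$ from $|N|$ if $\bar s_n$ is from $|M|$, and from $|M|$ if $\bar s_n$ is from $|N|$; $E\bar t_j=q_j$; $h_j$ is a partial isomorphism with $(h^*_n)_{q_j}\subseteq h_j$; $h_j$ maps $\bar s_n\upharpoonright q_j$ to $\bar t_j$ if $\bar s_n$ is from $|M|$, and maps $\bar t_j$ to $\bar s_n\upharpoonright q_j$ if $\bar s_n$ is from $|N|$; and moreover $E\bar s_n=\bigvee_{j\in J_n}E\bar t_j$. At move $n+1$ player I must choose $\alpha_{n+1}<\alpha_n$, select $j\in J_n$, and ensure $E\bar s_{n+1}\le E\bar t_j$; then $h^*_{n+1}$ is the $h_j$ for this $j$. A player who cannot make a legal move loses and the other player wins.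
   Formalization: In the Forth and Back clauses defining Q_α(p), the tuple is also required to have extent at most p; this only excludes the empty tuple (extent ⊤) when p ≠ ⊤, since admitting it there makes the claimed equivalence false. *)

(* Defs.v *)
From HB Require Import structures.
From mathcomp Require Import all_boot all_order.
From mathcomp Require Import all_classical.
From mathcomp Require wochoice.

Set Implicit Arguments.
Unset Strict Implicit.
Unset Printing Implicit Defensive.
Import Order.TTheory.
Local Open Scope order_scope.

(** * Ordinals and cardinals *)

(* An ordinal is presented as an element of a well-ordered type: [alpha : O]
   stands for the order type of its strict initial segment.  [O] is arbitrary,
   so every ordinal is covered. *)
Definition well_ordered d (O : orderType d) : Prop :=
  wochoice.well_order (<=%O : rel O).

(* A cardinal is an initial ordinal: a well-ordered type that does not inject
   into any of its strict initial segments.  The ordinals smaller than the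
   cardinal are the elements [gamma : K]. *)
Definition is_cardinal d (K : orderType d) : Prop :=
  well_ordered K /\
  forall gamma : K, ~ card_le [set: K]%classic [set i : K | i < gamma]%classic.

(* A tuple of length [gamma] in [X] is a function [seg gamma -> X]. *)
Definition seg d (K : orderType d) (gamma : K) : Type := {i : K | i < gamma}.

Definition ord_zero d (O : orderType d) (alpha : O) : Prop :=
  forall beta : O, ~~ (beta < alpha).

Definition ord_succ d (O : orderType d) (beta alpha : O) : Prop :=
  beta < alpha /\ forall delta : O, delta < alpha -> delta <= beta.

Definition ord_limit d (O : orderType d) (alpha : O) : Prop :=
  ~ ord_zero alpha /\
  forall beta : O, beta < alpha -> exists2 delta : O, beta < delta & delta < alpha.

(** * Complete Heyting algebras *)

HB.mixin Record TBLattice_isCompleteHeyting d T of Order.TBLattice d T := {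
  bigjoin : set T -> T;
  bigjoin_ub : forall (A : set T) (x : T), A x -> x <= bigjoin A;
  bigjoin_le : forall (A : set T) (y : T),
    (forall x, A x -> x <= y) -> bigjoin A <= y;
  himp : T -> T -> T;
  le_himp : forall p q r : T, (r <= himp p q) = (Order.meet r p <= q)
}.

#[short(type="completeHeytingType")]
HB.structure Definition CompleteHeyting d :=
  { T of TBLattice_isCompleteHeyting d T & Order.TBLattice d T }.

Definition bigmeet d (Omega : completeHeytingType d) (A : set Omega) : Omega :=
  bigjoin (fun p : Omega => forall q, A q -> p <= q).

Lemma bigmeet_lb d (Omega : completeHeytingType d) (A : set Omega) (x : Omega) :
  A x -> bigmeet A <= x.
Proof. by move=> Ax; apply: bigjoin_le => p; apply. Qed.

Lemma le_bigmeet d (Omega : completeHeytingType d) (A : set Omega) (y : Omega) :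
  (forall x, A x -> y <= x) -> y <= bigmeet A.
Proof. exact: bigjoin_ub. Qed.

(** * Presheaves *)

Section EqualityValue.
Context {d : Order.disp_t} {Omega : completeHeytingType d}.

Definition eq_value (S : Type) (E : S -> Omega) (r : S -> Omega -> S)
    (a b : S) : Omega :=
  bigjoin (fun p : Omega => p <= Order.meet (E a) (E b) /\ r a p = r b p).

Record presheaf := Presheaf {
  section :> Type;
  ext : section -> Omega;
  restr : section -> Omega -> section;
  restr_ext : forall a, restr a (ext a) = a;
  ext_restr : forall a p, ext (restr a p) = Order.meet (ext a) p;
  restr_restr : forall a p q, restr (restr a p) q = restr a (Order.meet p q);
  presheaf_extensional : forall a b,
    ext a = ext b -> ext b = eq_value ext restr a b -> a = b
}.

Definition eqv (M : presheaf) (a b : M) : Omega := eq_value (@ext M) (@restr M) a b.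

(* Extent and equality of families; the index type is ['I_n] for the arguments
   of an n-ary symbol and [seg gamma] for tuples of length [gamma]. *)
Definition extt (M : presheaf) (I : Type) (a : I -> M) : Omega :=
  bigmeet (fun p : Omega => exists i, p = ext (a i)).

Definition eqvt (M : presheaf) (I : Type) (a b : I -> M) : Omega :=
  bigmeet (fun p : Omega => exists i, p = eqv (a i) (b i)).

Lemma extt_empty (M : presheaf) (I : Type) (a : I -> M) :
  (I -> False) -> extt a = \top.
Proof.
move=> I0; apply/eqP; rewrite -le1x; apply: le_bigmeet => p [i _].
by case: (I0 i).
Qed.

Lemma extt_le (M : presheaf) (I : Type) (a : I -> M) (i : I) :
  extt a <= ext (a i).
Proof. by apply: bigmeet_lb; exists i. Qed.

End EqualityValue.

Arguments presheaf {d} Omega.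

(** * Structures *)

Record signature d (Omega : completeHeytingType d) := Signature {
  rel_sym : Type;
  rel_arity : rel_sym -> nat;
  fun_sym : Type;
  fun_arity : fun_sym -> nat;
  const_sym : presheaf Omega
}.

Record pSh d (Omega : completeHeytingType d) (L : signature Omega) := PSh {
  carrier :> presheaf Omega;
  rel_int : forall R : rel_sym L, ('I_(rel_arity R) -> carrier) -> Omega;
  rel_int_ext : forall R (a : 'I_(rel_arity R) -> carrier),
    @rel_int R a <= extt a;
  rel_int_eqv : forall R (a b : 'I_(rel_arity R) -> carrier),
    Order.meet (eqvt a b) (@rel_int R a) <= @rel_int R b;
  fun_int : forall f : fun_sym L, ('I_(fun_arity f) -> carrier) -> carrier;
  fun_int_ext : forall f (a : 'I_(fun_arity f) -> carrier),
    ext (@fun_int f a) = extt a;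
  fun_int_eqv : forall f (a b : 'I_(fun_arity f) -> carrier),
    eqvt a b <= eqv (@fun_int f a) (@fun_int f b);
  const_int : const_sym L -> carrier;
  const_int_ext : forall c, ext (const_int c) = ext c;
  const_int_restr : forall c p, const_int (restr c p) = restr (const_int c) p
}.

Arguments rel_int {d Omega L} _ R _.
Arguments fun_int {d Omega L} _ f _.
Arguments const_int {d Omega L} _ _.

(** * Partial isomorphisms *)

Section PartialIso.
Context {d : Order.disp_t} {Omega : completeHeytingType d} {L : signature Omega}.
Variables M N : pSh L.

(* The extension of a graph [g] to the generated sets of sections:
   h(a|p) = h(a)|p. *)
Definition extend_graph (g : M -> N -> Prop) (x : M) (y : N) : Prop :=
  exists a b p, [/\ g a b, x = restr a p & y = restr b p].

(* A bijection between a subset of |M| and a subset of |N| is given by its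
   graph. *)
Record piso := PIso {
  graph : M -> N -> Prop;
  graph_fun : forall a b b', graph a b -> graph a b' -> b = b';
  graph_inj : forall a a' b, graph a b -> graph a' b -> a = a';
  graph_eqv : forall a0 a1 b0 b1, graph a0 b0 -> graph a1 b1 ->
    eqv a0 a1 = eqv b0 b1;
  piso_eqv : forall x0 x1 y0 y1,
    extend_graph graph x0 y0 -> extend_graph graph x1 y1 ->
    eqv x0 x1 = eqv y0 y1;
  piso_rel : forall (R : rel_sym L)
      (x : 'I_(rel_arity R) -> M) (y : 'I_(rel_arity R) -> N),
    (forall i, extend_graph graph (x i) (y i)) ->
    rel_int M R x = rel_int N R y;
  piso_const : forall (c : const_sym L) x y,
    extend_graph graph x y ->
    eqv x (const_int M c) = eqv y (const_int N c);
  piso_fun : forall (f : fun_sym L)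
      (x : 'I_(fun_arity f) -> M) (y : 'I_(fun_arity f) -> N) xn yn,
    (forall i, extend_graph graph (x i) (y i)) -> extend_graph graph xn yn ->
    eqv (fun_int M f x) xn = eqv (fun_int N f y) yn
}.

(* [maps h x y]: x is in the domain of the extended map h, and h(x) = y. *)
Definition maps (h : piso) : M -> N -> Prop := extend_graph (graph h).

(* h_q is included in h'. *)
Definition sub_at (q : Omega) (h h' : piso) : Prop :=
  forall x y, maps h x y -> ext x = q -> maps h' x y.

End PartialIso.

Arguments piso {d Omega L} M N.

(** * The classes Q_alpha(p) *)

Section BackAndForth.
Context {d : Order.disp_t} {Omega : completeHeytingType d} {L : signature Omega}.
Context {dK : Order.disp_t} (K : orderType dK).
Context {M N : pSh L}.

(* In both clauses the requirement that the extent of the given tuple be at most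
   p follows from its entries being in |M|p| (resp. |N|p|) if the tuple is
   nonempty.  It only matters for the empty tuple, whose extent is \top, which is
   thus a tuple over M|p only when p = \top, just as in the game, where player I
   may play the empty tuple only in that case. *)
Definition forth (Qb : Omega -> piso M N -> Prop) (p : Omega) (h : piso M N)
    : Prop :=
  forall (gamma : K) (c : seg gamma -> M),
    (forall i, ext (c i) <= p) -> extt c <= p ->
  exists F : set (piso M N * Omega * (seg gamma -> N)),
    (forall hj qj dj, F (hj, qj, dj) ->
      [/\ Qb qj hj,
          sub_at qj h hj,
          forall i, ext (dj i) <= extt c,
          extt dj = qj
        & forall i, maps hj (restr (c i) qj) (dj i)]) /\
    bigjoin (fun q : Omega => exists hj dj, F (hj, q, dj)) = extt c.

Definition back (Qb : Omega -> piso M N -> Prop) (p : Omega) (h : piso M N)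
    : Prop :=
  forall (gamma : K) (e : seg gamma -> N),
    (forall i, ext (e i) <= p) -> extt e <= p ->
  exists F : set (piso M N * Omega * (seg gamma -> M)),
    (forall hj qj cj, F (hj, qj, cj) ->
      [/\ Qb qj hj,
          sub_at qj h hj,
          forall i, ext (cj i) <= extt e,
          extt cj = qj
        & forall i, maps hj (cj i) (restr (e i) qj)]) /\
    bigjoin (fun q : Omega => exists hj cj, F (hj, q, cj)) = extt e.

Context {dO : Order.disp_t} {O : orderType dO}.

(* Transfinite recursion on alpha, for well-ordered O. *)
Inductive Q : O -> Omega -> piso M N -> Prop :=
| Q_zero alpha p h : ord_zero alpha -> Q alpha p h
| Q_succ alpha beta p h : ord_succ beta alpha ->
    Q beta p h -> forth (Q beta) p h -> back (Q beta) p h -> Q alpha p h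
| Q_limit alpha p h : ord_limit alpha ->
    (forall beta, beta < alpha -> Q beta p h) -> Q alpha p h.

End BackAndForth.

Arguments Q {d Omega L dK} K {M N dO O} alpha p h.

(** * The game *)

Section Game.
Context {d : Order.disp_t} {Omega : completeHeytingType d} {L : signature Omega}.
Context {dK : Order.disp_t} (K : orderType dK).
Context {dO : Order.disp_t} (O : orderType dO).
Variables M N : pSh L.

(* A tuple from |M| or from |N|.  The tagged sum is the union of the two sets of
   tuples under the assumption that |M| and |N| are disjoint. *)
Definition side (gamma : K) : Type := ((seg gamma -> M) + (seg gamma -> N))%type.

Definition ext_side (gamma : K) (s : side gamma) : Omega :=
  match s with inl a => extt a | inr b => extt b end.

Record moveI := MoveI {
  lhI : K;
  tupI : side lhI;
  ordI : O
}.

(* An element (h_j, q_j, t_j) of an answer of player II to a tuple of length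
   [gamma]. *)
Record option2 (gamma : K) := Option2 {
  isoII : piso M N;
  extII : Omega;
  tupII : side gamma
}.

Definition legal_option (h : piso M N) (gamma : K) (s : side gamma)
    (r : option2 gamma) : Prop :=
  [/\ ext_side (tupII r) = extII r,
      sub_at (extII r) h (isoII r)
    & match s, tupII r with
      | inl s', inr t => forall i, maps (isoII r) (restr (s' i) (extII r)) (t i)
      | inr s', inl t => forall i, maps (isoII r) (t i) (restr (s' i) (extII r))
      | _, _ => False
      end].

Definition legal_answer (h : piso M N) (gamma : K) (s : side gamma)
    (F : set (option2 gamma)) : Prop :=
  (forall r, F r -> legal_option h s r) /\
  ext_side s = bigjoin (fun q : Omega => exists2 r, F r & q = ext_side (tupII r)).

Definition legal_moveI (p : Omega) (beta : O) (m : moveI) : Prop :=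
  ext_side (tupI m) <= p /\ ordI m < beta.

(* A completed round: the move of player I and the element of the answer of
   player II that player I selects at the next move. *)
Definition round : Type := {m : moveI & option2 (lhI m)}.

(* The answer of player II as a function of the completed rounds (most recent
   first) and of the current move of player I. *)
Definition strategyII : Type :=
  seq round -> forall m : moveI, set (option2 (lhI m)).

(* [reached sigma alpha p h past hstar q beta]: [past] is a position in which
   player I has moved legally and player II has followed sigma; then hstar is
   the current partial isomorphism, and in the next move player I must play a
   tuple of extent at most q and an ordinal smaller than beta. *)
Inductive reached (sigma : strategyII) (alpha : O) (p : Omega) (h : piso M N) :
    seq round -> piso M N -> Omega -> O -> Prop :=
| reached_start : reached sigma alpha p h [::] h p alpha
| reached_round past hstar q beta (m : moveI) (r : option2 (lhI m)) :
    reached sigma alpha p h past hstar q beta ->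
    legal_moveI q beta m ->
    sigma past m r ->
    reached sigma alpha p h (existT _ m r :: past)
      (isoII r) (ext_side (tupII r)) (ordI m).

(* All plays are finite, because the ordinals played decrease.  So sigma is
   winning as soon as it always provides a legal answer. *)
Definition winningII (gamma : K) (alpha : O) (a : seg gamma -> M)
    (h : piso M N) (sigma : strategyII) : Prop :=
  forall past hstar q beta,
    reached sigma alpha (extt a) h past hstar q beta ->
    forall m : moveI, legal_moveI q beta m ->
      legal_answer hstar (tupI m) (sigma past m).

End Game.

Arguments strategyII {d Omega L dK} K {dO} O M N.
Arguments winningII {d Omega L dK K dO O M N gamma} alpha a h sigma.

(* Main.v *)
Require Import Defs.
From mathcomp Require Import all_boot all_order.
From mathcomp Require Import all_classical.

(** Unfolding the recursion, [h] is in Q_alpha(p) iff for every [beta < alpha]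
    the back-and-forth clauses hold at [p] with witnesses in Q_beta.  Every
    tuple [s] can be cut down to [s|Es] without changing its legal answers, so
    these clauses say that the set of all legal options [(h_j, q_j, t_j)] with
    [h_j] in Q_beta(q_j) is a legal answer of player II.  Always playing this
    largest set is therefore a winning strategy; conversely, well-founded
    induction on the ordinal bound shows that all positions [(h*, q, beta)]
    reached under a winning strategy satisfy [h*] in Q_beta(q). *)

Set Implicit Arguments.
Unset Strict Implicit.
Unset Printing Implicit Defensive.
Import Order.TTheory.
Local Open Scope order_scope.

Lemma well_ordered_ind d (O : orderType d) (P : O -> Prop) :
  well_ordered O ->
  (forall alpha, (forall beta, beta < alpha -> P beta) -> P alpha) ->
  forall alpha, P alpha.
Proof.
move=> wo IH alpha; apply: contrapT => nPa.
have [|b [[/asboolP nPb bmin] _]] := wo [pred x | `[< ~ P x >]].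
  by exists alpha; apply/asboolP.
apply: nPb; apply: IH => c ltcb; apply: contrapT => nPc.
by have := bmin c (asboolT nPc); rewrite leNgt ltcb.
Qed.

Section Presheaf.
Context {d : Order.disp_t} {Omega : completeHeytingType d}.
Implicit Types (M : presheaf Omega) (p q : Omega).

Lemma bigjoin_mono (A B : set Omega) :
  (forall x, A x -> B x) -> bigjoin A <= bigjoin B.
Proof. by move=> AB; apply: bigjoin_le => x /AB; apply: bigjoin_ub. Qed.

(** Extents thus become equality values, which partial isomorphisms preserve. *)
Lemma eqv_refl M (a : M) : eqv a a = ext a.
Proof.
apply/le_anti/andP; split.
  by apply: bigjoin_le => p []; rewrite meetxx.
by apply: bigjoin_ub; rewrite meetxx.
Qed.

Lemma ext_restr_extt M (I : Type) (s : I -> M) i :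
  ext (restr (s i) (extt s)) = extt s.
Proof. by rewrite ext_restr; apply/meet_idPr/extt_le. Qed.

Lemma extt_restr_extt M (I : Type) (s : I -> M) :
  extt (fun i => restr (s i) (extt s)) = extt s.
Proof.
apply/le_anti/andP; split; apply: le_bigmeet => x [i ->].
  by apply: le_trans (extt_le _ i) _; rewrite ext_restr_extt extt_le.
by rewrite ext_restr_extt.
Qed.

End Presheaf.

Section BackAndForth.
Context {d : Order.disp_t} {Omega : completeHeytingType d} {L : signature Omega}.
Context {dK : Order.disp_t} {K : orderType dK} {M N : pSh L}.
Implicit Types (h k : piso M N) (p q : Omega) (Qb : Omega -> piso M N -> Prop).

Lemma maps_ext h x y : maps h x y -> ext x = ext y.
Proof. by move=> hxy; rewrite -!eqv_refl; apply: (piso_eqv (p := h)). Qed.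

(** Each entry of the answer corresponds under [isoII r] to an entry of [s] cut down, and extents
    are preserved. *)
Lemma legal_option_ext h (gamma : K) (s : side M N gamma)
    (r : option2 M N gamma) : legal_option h s r -> extII r <= ext_side s.
Proof.
case: r => k q t [/= <- _]; case: s t => [s|s] [t|t] //= kst;
  apply: le_bigmeet => x [i ->]; apply: le_trans (extt_le t i) _.
- by rewrite -(maps_ext (kst i)) ext_restr leIl.
- by rewrite (maps_ext (kst i)) ext_restr leIl.
Qed.

(** Taking all admissible options at once spares choosing one answer per move. *)
Definition options_in Qb h (gamma : K) (s : side M N gamma) :
    set (option2 M N gamma) :=
  fun r => legal_option h s r /\ Qb (extII r) (isoII r).

(** [F] is contained in the larger set, so the join still covers the extent of [s]; by
    [legal_option_ext] it cannot exceed it. *)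
Lemma legal_options_in Qb h (gamma : K) (s : side M N gamma)
    (F : set (option2 M N gamma)) :
  legal_answer h s F -> (forall r, F r -> Qb (extII r) (isoII r)) ->
  legal_answer h s (options_in Qb h s).
Proof.
move=> [Flegal Fext] FQ; split=> [r []//|].
apply/le_anti/andP; split.
  rewrite Fext; apply: bigjoin_mono => q [r Fr ->].
  by exists r => //; split; [apply: Flegal|apply: FQ].
apply: bigjoin_le => q [r [rlegal _] ->].
by case: (rlegal) => -> _ _; apply: legal_option_ext rlegal.
Qed.

Lemma forth_backP Qb p h :
  forth K Qb p h /\ back K Qb p h <->
  forall (gamma : K) (s : side M N gamma), ext_side s <= p ->
    legal_answer h s (options_in Qb h s).
Proof.
split=> [[forth_h back_h] gamma [s|s] /= sp|legal].
(* Entries of [s] may have extents not below [p]; after cutting to [extt s] they all have extent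
   [extt s], which is below [p]. *)
- have [||F [FP Fext]] := forth_h gamma (fun i => restr (s i) (extt s)).
  + by move=> i; rewrite ext_restr_extt.
  + by rewrite extt_restr_extt.
  pose G : set (option2 M N gamma) := fun r =>
    exists2 t, tupII r = inr t & F (isoII r, extII r, t).
  rewrite extt_restr_extt in FP Fext.
  apply: (legal_options_in (F := G)); last first.
    by move=> r [t _ /FP[]].
  split=> [[k q _] [t /= -> Frt]|/=].
    have [_ hk _ tq kst] := FP _ _ _ Frt.
    split=> //= i; have := kst i; rewrite restr_restr.
    (* Cutting to [extt s] and then to [q] is cutting to [q] alone, as [q] is one of the extents
       joined to [extt s]. *)
    suff /meet_idPr -> : q <= extt s by [].
    by rewrite -Fext; apply: bigjoin_ub; exists k, t.
  rewrite -Fext; congr bigjoin; apply/predeqP => q; split.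
    move=> [k [t Fkt]]; exists (Option2 k q (inr t)); first by exists t.
    by have [] := FP _ _ _ Fkt.
  move=> [[k q' _] [t /= -> Ft] ->] /=.
  by exists k, t; have [_ _ _ -> _] := FP _ _ _ Ft.
- have [||F [FP Fext]] := back_h gamma (fun i => restr (s i) (extt s)).
  + by move=> i; rewrite ext_restr_extt.
  + by rewrite extt_restr_extt.
  pose G : set (option2 M N gamma) := fun r =>
    exists2 t, tupII r = inl t & F (isoII r, extII r, t).
  rewrite extt_restr_extt in FP Fext.
  apply: (legal_options_in (F := G)); last first.
    by move=> r [t _ /FP[]].
  split=> [[k q _] [t /= -> Frt]|/=].
    have [_ hk _ tq kst] := FP _ _ _ Frt.
    split=> //= i; have := kst i; rewrite restr_restr.
    suff /meet_idPr -> : q <= extt s by [].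
    by rewrite -Fext; apply: bigjoin_ub; exists k, t.
  rewrite -Fext; congr bigjoin; apply/predeqP => q; split.
    move=> [k [t Fkt]]; exists (Option2 k q (inl t)); first by exists t.
    by have [] := FP _ _ _ Fkt.
  move=> [[k q' _] [t /= -> Ft] ->] /=.
  by exists k, t; have [_ _ _ -> _] := FP _ _ _ Ft.
split=> gamma s _ sp.
- have [_ /= sext] := legal gamma (inl s) sp.
  exists (fun '(k, q, t) => options_in Qb h (inl s) (Option2 k q (inr t))).
  split=> [k q t [opt Qk]|].
    have le_q := legal_option_ext opt; case: opt => /= tq hk kst.
    (* Each [t i] is the image of a section cut to [q], so its extent is at most [q], hence at most
       [extt s]. *)
    split=> // i; apply: le_trans le_q => /=.
    by rewrite -(maps_ext (kst i)) ext_restr leIr.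
  rewrite [RHS]sext; congr bigjoin; apply/predeqP => q; split.
    move=> [k [t opt]]; exists (Option2 k q (inr t)) => //=.
    by case: opt => [[]].
  move=> [[k q' [t|t]] /= opt ->]; first by case: opt => [[]].
  by exists k, t; case: (opt) => [[/= -> _ _] _].
- have [_ /= sext] := legal gamma (inr s) sp.
  exists (fun '(k, q, t) => options_in Qb h (inr s) (Option2 k q (inl t))).
  split=> [k q t [opt Qk]|].
    have le_q := legal_option_ext opt; case: opt => /= tq hk kst.
    split=> // i; apply: le_trans le_q => /=.
    by rewrite (maps_ext (kst i)) ext_restr leIr.
  rewrite [RHS]sext; congr bigjoin; apply/predeqP => q; split.
    move=> [k [t opt]]; exists (Option2 k q (inl t)) => //=.
    by case: opt => [[]].
  move=> [[k q' [t|t]] /= opt ->]; last by case: opt => [[]].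
  by exists k, t; case: (opt) => [[/= -> _ _] _].
Qed.

Context {dO : Order.disp_t} {O : orderType dO} (O_wo : well_ordered O).

(** Below a successor, [beta] is the predecessor or smaller than it; below a limit, some [delta]
    lies strictly between [beta] and [alpha], and the induction hypothesis applies to [delta]. *)
Lemma Q_forth_back (alpha : O) p h : Q K alpha p h ->
  forall beta, beta < alpha -> forth K (Q K beta) p h /\ back K (Q K beta) p h.
Proof.
move: alpha; apply: (well_ordered_ind O_wo) => alpha IH Qh beta ba.
case: Qh IH ba => {alpha p h} [alpha p h alpha0|alpha delta p h [da dmax]|alpha p h [_ lim]].
- by rewrite (negPf (alpha0 _)).
- move=> Qd fd bd IH /dmax; rewrite le_eqVlt => /orP[/eqP-> //|].
  exact: IH.
- by move=> Qlt IH /lim[delta bd da]; apply: IH (Qlt _ da) _ bd.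
Qed.

(** The hypothesis passes to smaller ordinals, so induction puts [h] in every earlier class; the
    three constructors then cover all [alpha]. *)
Lemma forth_back_Q (alpha : O) p h :
  (forall beta, beta < alpha ->
    forth K (Q K beta) p h /\ back K (Q K beta) p h) ->
  Q K alpha p h.
Proof.
move: alpha; apply: (well_ordered_ind O_wo) => alpha IH fb.
have Qlt beta : beta < alpha -> Q K beta p h.
  by move=> ba; apply: IH => // delta db; apply/fb/(lt_trans db).
have [alpha0|nalpha0] := pselect (ord_zero alpha); first exact: Q_zero.
have [[beta sab]|nsucc] := pselect (exists beta, ord_succ beta alpha).
  have ba := sab.1; have [? ?] := fb _ ba.
  by apply: Q_succ sab _ _ _ => //; apply: Qlt.
(* If nothing lay strictly between [beta] and [alpha], then [alpha] would be the successor of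
   [beta]. *)
apply: Q_limit Qlt; split=> // beta ba; apply: contrapT => nex.
apply: nsucc; exists beta; split=> // delta da; rewrite leNgt; apply/negP => bd.
by apply: nex; exists delta.
Qed.

End BackAndForth.

Section Strategy.
Context {d : Order.disp_t} {Omega : completeHeytingType d} {L : signature Omega}.
Context {dK : Order.disp_t} {K : orderType dK} {M N : pSh L}.
Context {dO : Order.disp_t} {O : orderType dO} (O_wo : well_ordered O).

(** A strategy sees only the completed rounds, so it must recover h* from the latest one. *)
Definition current (h : piso M N) (past : seq (round K O M N)) : piso M N :=
  if past is existT _ r :: _ then isoII r else h.

Definition largest_strategy (h : piso M N) : strategyII K O M N :=
  fun past m => options_in (Q K (ordI m)) (current h past) (tupI m).

Lemma largest_strategy_winning (gamma : K) (alpha : O) (a : seg gamma -> M) h :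
  Q K alpha (extt a) h -> winningII alpha a h (largest_strategy h).
Proof.
move=> Qh past hstar q beta pos.
have [-> Qhstar] : hstar = current h past /\ Q K beta q hstar.
  (* No induction on the play: the last selected option itself carries its membership in the class
     for the ordinal just played. *)
  case: pos => {past hstar q beta} [//|past hstar q beta m r _ _ [ropt ?]].
  by case: ropt => -> _ _.
move=> [ll s o] [/= sq ltob].
exact: (forth_backP _ _ _).1 (Q_forth_back O_wo Qhstar ltob) _ _ sq.
Qed.

Lemma winning_reached_Q (sigma : strategyII K O M N) (gamma : K) (alpha : O)
    (a : seg gamma -> M) h past hstar q beta :
  winningII alpha a h sigma ->
  reached sigma alpha (extt a) h past hstar q beta -> Q K beta q hstar.
Proof.
move=> win; move: beta past hstar q.
apply: (well_ordered_ind O_wo) => beta IH past hstar q pos.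
(* Let player I play [s] with [delta]: every option in the answer of [sigma] leads to a position
   with bound [delta], where the induction hypothesis applies. *)
apply: (forth_back_Q O_wo) => delta db; apply/forth_backP => ll s sq.
have legal_m : legal_moveI q beta (MoveI s delta) by [].
have legal_F := win _ _ _ _ pos _ legal_m.
apply: legal_options_in (legal_F) _ => r Fr.
have [<- _ _] := legal_F.1 r Fr.
exact: IH db _ _ _ (reached_round pos legal_m Fr).
Qed.

End Strategy.

Theorem theorem4p2
  (d : Order.disp_t) (Omega : completeHeytingType d) (L : signature Omega)
  (dK : Order.disp_t) (mu : orderType dK) (mu_cardinal : is_cardinal mu)
  (dO : Order.disp_t) (O : orderType dO) (O_wo : well_ordered O) (alpha : O)
  (M N : pSh L) (gamma : mu) (a : seg gamma -> M) (b : seg gamma -> N)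
  (h : piso M N) (hab : forall i : seg gamma, maps h (a i) (b i)) :
  Q mu alpha (extt a) h <->
  exists sigma : strategyII mu O M N, winningII alpha a h sigma.
Proof.
split=> [Qh|[sigma win]].
  by exists (largest_strategy h); apply: largest_strategy_winning.
exact: (winning_reached_Q O_wo win (reached_start _ _ _ _)).
Qed.
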